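(* There exist universal positive constants $\epsilon_0,c_1,\sigma,\tau$ such that the following holds for every finite graph $\mathcal{G}$. Let $B\in\mathbb{S}^{m+n}$, and the integers $n,m,k$, be constructed from $\mathcal{G}$ by the $(P_1)$ input construction, and let $\epsilon_5:=c_1\epsilon_0k^{-\sigma}m^{-\tau}$. Then: (i) If $\mathcal{G}$ is 3-colorable, there exists $\mathbf{d}\in\mathbb{R}_+^{n+m}$ such that $B-\operatorname{Diag}(\mathbf{d})\succeq 0$ and $\operatorname{rank}(B-\operatorname{Diag}(\mathbf{d}))\le m+3$. (ii) Conversely, if there exist $\mathbf{d}\in\mathbb{R}_+^{n+m}$ and $H\in\mathbb{S}^{n+m}$ such that $\|H\|_F\le\epsilon_5$, $B-\operatorname{Diag}(\mathbf{d})+H\succeq 0$, and $\operatorname{rank}(B-\operatorname{Diag}(\mathbf{d})+H)\le m+3$, then $\mathcal{G}$ is 3-colorable.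
   Context: All graphs are finite, undirected, simple and loopless; $\mathcal{V}(\cdot)$, $\mathcal{E}(\cdot)$ denote vertex and edge sets. $\mathbb{S}^N$ is the space of real symmetric $N\times N$ matrices, $\succeq0$ means positive semidefinite, $\|\cdot\|_F$ is the Frobenius norm, $\mathbb{R}_+^N$ is the nonnegative orthant, $\operatorname{Diag}(\mathbf{d})$ is the diagonal matrix with diagonal $\mathbf{d}$. Peeters supergraph: $\mathcal{G}'$ is obtained from $\mathcal{G}$ by adding, for each unordered pair of distinct vertices $i,j\in\mathcal{V}(\mathcal{G})$ (adjacent or not, listed in some fixed order $i,j$), four new vertices $a_{ij},b_{ij},c_{ij},d_{ij}$ and the nine edges $\{i,a_{ij}\},\{i,b_{ij}\},\{a_{ij},b_{ij}\},\{j,c_{ij}\},\{j,d_{ij}\},\{c_{ij},d_{ij}\},\{a_{ij},j\},\{i,d_{ij}\},\{b_{ij},c_{ij}\}$. $(P_1)$ input construction: let $n:=3|\mathcal{V}(\mathcal{G}')|$; every vertex $i$ of $\mathcal{G}'$ corresponds to three indices $i^{(1)},i^{(2)},i^{(3)}$ with parent $\pi(i^{(\mu)})=i$. A nonedge of $\mathcal{G}'$ is a pair of distinct nonadjacent vertices. Define $A\in\mathbb{S}^n$ by $A(u,v)=2$ if $\{\pi(u),\pi(v)\}$ is a nonedge of $\mathcal{G}'$; $A(u,v)=0$ if $\{\pi(u),\pi(v)\}\in\mathcal{E}(\mathcal{G}')$; $A(u,v)=1$ if $\pi(u)=\pi(v)$ and $u\ne v$; $A(u,u)=0$. Let $\mathcal{G}''$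 be the graph on the $n$ indices whose edges are the pairs $\{u,v\}$ such that $\{\pi(u),\pi(v)\}$ is a nonedge of $\mathcal{G}'$, and let $m:=|\mathcal{E}(\mathcal{G}'')|$. Let $K\in\{0,1\}^{n\times m}$ be the node-edge incidence matrix of $\mathcal{G}''$ (the column of edge $\{u,v\}$ has ones exactly in rows $u$ and $v$). Finally $$k:=2\max_{v\in\mathcal{V}(\mathcal{G}'')}\deg(v)+1,\qquad B:=\begin{bmatrix} 0 & K^{\top} \\ K & A \end{bmatrix}+kI\in\mathbb{S}^{m+n}.$$ *)

(* Defs.v *)
From mathcomp Require Import all_boot all_order all_algebra.
From mathcomp Require Import reals exp.

Set Implicit Arguments.
Unset Strict Implicit.
Unset Printing Implicit Defensive.

Import Order.TTheory GRing.Theory Num.Theory.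
Local Open Scope ring_scope.

Record sgraph := SGraph {
  vert :> finType;
  adj : rel vert;
  adj_sym : symmetric adj;
  adj_irr : irreflexive adj }.

Definition nonedge (G : sgraph) : rel G := fun x y => (x != y) && ~~ adj x y.

Definition edges (G : sgraph) : {set {set G}} :=
  [set [set p.1; p.2] | p : G * G & adj p.1 p.2].

Definition degree (G : sgraph) (x : G) : nat := #|[set y | adj x y]|.

Definition colorable (q : nat) (G : sgraph) : Prop :=
  exists c : G -> 'I_q, forall x y, adj x y -> c x != c y.

(* Rows follow the enumeration of the vertices, columns that of the edges. *)
Definition incidence_mx (R : realType) (G : sgraph) :
    'M[R]_(#|vert G|, #|edges G|) :=
  \matrix_(i, j) ((enum_val i : G) \in (enum_val j : {set G}))%:R.

(* An unordered pair of distinct vertices is represented by the ordered pair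
   that is increasing for the canonical enumeration of the vertices. Reversing
   the order of i and j gives an isomorphic supergraph: the nine edges are
   invariant under exchanging i with j, a with d, and b with c. *)
Definition dpairs (V : finType) : finType :=
  {p : V * V | (enum_rank p.1 < enum_rank p.2)%N}.

Definition peeters_vert (V : finType) : finType := (V + dpairs V * 'I_4)%type.

Definition gadget (V : finType) (p : dpairs V) :
    seq (peeters_vert V * peeters_vert V) :=
  let i : peeters_vert V := inl (val p).1 in
  let j : peeters_vert V := inl (val p).2 in
  let a : peeters_vert V := inr (p, @Ordinal 4 0 isT) in
  let b : peeters_vert V := inr (p, @Ordinal 4 1 isT) in
  let c : peeters_vert V := inr (p, @Ordinal 4 2 isT) in
  let d : peeters_vert V := inr (p, @Ordinal 4 3 isT) in
  [:: (i, a); (i, b); (a, b); (j, c); (j, d); (c, d); (a, j); (i, d); (b, c)].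

Definition peeters_adj (G : sgraph) : rel (peeters_vert G) := fun x y =>
  (if (x, y) is (inl u, inl v) then adj u v else false)
  || [exists p : dpairs G, ((x, y) \in gadget p) || ((y, x) \in gadget p)].

Lemma peeters_adj_sym (G : sgraph) : symmetric (@peeters_adj G).
Proof.
move=> x y; rewrite /peeters_adj; congr orb.
  by case: x y => [u|u] [v|v] //; apply: adj_sym.
by apply: eq_existsb => p; rewrite orbC.
Qed.

Lemma peeters_adj_irr (G : sgraph) : irreflexive (@peeters_adj G).
Proof.
have gadget_neq (p : dpairs G) : all (fun e => e.1 != e.2) (gadget p).
  by rewrite /= !andbT; apply/and3P; split; apply/eqP => -[].
move=> x; apply/negP => /orP[|/existsP[p]].
  by case: x => // u; rewrite adj_irr.
by rewrite orbb => /(allP (gadget_neq p)); rewrite eqxx.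
Qed.

Definition peeters (G : sgraph) : sgraph :=
  SGraph (@peeters_adj_sym G) (@peeters_adj_irr G).

(* The index i^(mu) is the pair (i, mu), so its parent is the first component. *)
Definition p1_adj (G : sgraph) : rel (peeters G * 'I_3) :=
  fun u v => nonedge u.1 v.1.

Lemma p1_adj_sym (G : sgraph) : symmetric (@p1_adj G).
Proof. by move=> u v; rewrite /p1_adj /nonedge eq_sym adj_sym. Qed.

Lemma p1_adj_irr (G : sgraph) : irreflexive (@p1_adj G).
Proof. by move=> u; rewrite /p1_adj /nonedge eqxx. Qed.

Definition p1_graph (G : sgraph) : sgraph :=
  SGraph (@p1_adj_sym G) (@p1_adj_irr G).

Definition p1_n (G : sgraph) : nat := #|vert (p1_graph G)|.

Definition p1_m (G : sgraph) : nat := #|edges (p1_graph G)|.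

Definition p1_k (G : sgraph) : nat :=
  (2 * \max_(v : p1_graph G) degree v + 1)%N.

Lemma p1_nE (G : sgraph) : p1_n G = (3 * #|vert (peeters G)|)%N.
Proof. by rewrite /p1_n card_prod card_ord mulnC. Qed.

Definition p1_A (R : realType) (G : sgraph) : 'M[R]_(p1_n G) :=
  \matrix_(i, j)
    let u : p1_graph G := enum_val i in
    let v : p1_graph G := enum_val j in
    if nonedge u.1 v.1 then 2
    else if adj u.1 v.1 then 0
    else if u != v then 1 else 0.

Definition p1_B (R : realType) (G : sgraph) : 'M[R]_(p1_m G + p1_n G) :=
  let K := incidence_mx R (p1_graph G) in
  block_mx 0 K^T K (p1_A R G) + (p1_k G)%:R%:M.

Definition psdmx (R : realType) (N : nat) (M : 'M[R]_N) : Prop :=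
  M \is symmetricmx /\ forall x : 'cV[R]_N, 0 <= (x^T *m M *m x) 0 0.

Definition frobenius_norm (R : realType) (N : nat) (M : 'M[R]_N) : R :=
  Num.sqrt (\sum_(i < N) \sum_(j < N) M i j ^+ 2).

(* Main.v *)
Require Import Defs.
From mathcomp Require Import all_boot all_order all_algebra.
From mathcomp Require Import reals exp ring lra.

(** Write K for the incidence matrix, C and A' for the diagonal blocks of
    B - Diag(d), so that A' differs from A only on the diagonal, and
    S = A' - K C^-1 K^T for the Schur complement of the diagonal matrix C.  A
    rank at most m + 3 means that S is a positive semidefinite matrix of rank at
    most 3, that is, the Gram matrix of vectors in R^3.  The incidence matrix
    makes the entries of S at the nonedges of the supergraph adjustable through
    C, while those at its edges stay 0 and those between two copies of the same
    vertex stay 1.  So S describes vectors in R^3 for which adjacent vertices of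
    the supergraph are orthogonal, and the supergraph is designed so that such
    vectors force a 3-colouring of the original graph: each gadget makes the
    vectors of its two ends either parallel or orthogonal.

    Given a 3-colouring, [peeters_colorable] extends it to the supergraph and
    [p1_low_rank] takes for S the Gram matrix of the corresponding vectors of the
    standard basis.

    Conversely, under a perturbation H, the 2x2 minors on an edge and one of its
    ends give C >= 1/(4k), so the leading block is still invertible
    ([near_diag_unitmx]) and the off-diagonal entries of S outside the index
    graph move by at most a constant times (1 + k^2 m^3) |H|
    ([schur_term_perturbation]).  This is where the exponents 2 and 3 come from:
    they reduce the question to an absolute tolerance.  A Gram factorisation
    ([psd_gram]) and a normalisation ([near_gram_colorable]) give unit vectors
    in R^3 that are nearly orthogonal along edges.  Three nearly orthonormal
    vectors of R^3 nearly satisfy Parseval's identity ([near_parseval]), so every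
    gadget forces its ends to be nearly parallel or nearly orthogonal
    ([gadget_near_dichotomy]), and a largest set of pairwise nearly orthogonal
    vertices, of size at most three, provides the colours
    ([peeters_near_rep_colorable]). *)

Set Implicit Arguments.
Unset Strict Implicit.
Unset Printing Implicit Defensive.

Import Order.TTheory GRing.Theory Num.Theory.
Local Open Scope ring_scope.

(** * Positive semidefinite matrices *)

Lemma symmetricmxE (R : realType) (N : nat) (M : 'M[R]_N) :
  (M \is symmetricmx) = (M^T == M).
Proof.
rewrite [LHS]qualifE /= expr0 scale1r eq_sym; congr (_ == _).
by apply/matrixP=> i j; rewrite !mxE.
Qed.

Lemma psd_mulmx_tr (R : realType) (N r : nat) (F : 'M[R]_(N, r)) :
  psdmx (F *m F^T).
Proof.
split=> [|x]; first by rewrite symmetricmxE trmx_mul trmxK.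
have -> : x^T *m (F *m F^T) *m x = (F^T *m x)^T *m (F^T *m x).
  by rewrite trmx_mul trmxK !mulmxA.
by rewrite mxE sumr_ge0 // => i _; rewrite mxE -expr2 sqr_ge0.
Qed.

Lemma psd_congr (R : realType) (N r : nat) (M : 'M[R]_N) (T : 'M[R]_(N, r)) :
  psdmx M -> psdmx (T^T *m M *m T).
Proof.
case=> /[!symmetricmxE] /eqP symM posM; split=> [|x].
  by rewrite symmetricmxE !trmx_mul trmxK symM mulmxA.
have -> : x^T *m (T^T *m M *m T) *m x = (T *m x)^T *m M *m (T *m x).
  by rewrite trmx_mul !mulmxA.
exact: posM.
Qed.

Lemma psd_quad2 (R : realType) (N : nat) (M : 'M[R]_N) (i j : 'I_N) (a b : R) :
  psdmx M -> 0 <= a ^+ 2 * M i i + 2 * a * b * M i j + b ^+ 2 * M j j.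
Proof.
case=> /[!symmetricmxE] /eqP symM posM.
have := posM (a *: delta_mx i 0 + b *: delta_mx j 0).
have -> : (a *: delta_mx i 0 + b *: delta_mx j 0 : 'cV[R]_N)^T =
          a *: delta_mx 0 i + b *: delta_mx 0 j.
  by apply/matrixP=> k l; rewrite !mxE ![(l == _) && _]andbC.
rewrite !mulmxDl !mulmxDr -!scalemxAl -!scalemxAr.
have entry k l :
    ((delta_mx 0 k : 'rV[R]_N) *m M *m (delta_mx l 0 : 'cV[R]_N)) 0 0 = M k l.
  by rewrite -rowE -colE !mxE.
set X := delta_mx 0 i *m M; set Y := delta_mx 0 j *m M.
have E (x y z t : 'M[R]_1) : (x + y + (z + t)) 0 0 = x 0 0 + y 0 0 + (z 0 0 + t 0 0).
  by rewrite !mxE.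
have Z (c : R) (x : 'M[R]_1) : (c *: x) 0 0 = c * x 0 0 by rewrite mxE.
have Mji : M j i = M i j by rewrite -[in LHS]symM mxE.
rewrite E !Z !entry Mji => h; apply: (le_trans h).
by rewrite le_eqVlt; apply/orP; left; apply/eqP; ring.
Qed.

Lemma psd_diag_ge0 (R : realType) (N : nat) (M : 'M[R]_N) (i : 'I_N) :
  psdmx M -> 0 <= M i i.
Proof.
by move/(psd_quad2 i i 1 0); rewrite expr1n expr0n /= !mulr0 !mul0r !addr0 mul1r.
Qed.

Lemma psd_minor2 (R : realType) (N : nat) (M : 'M[R]_N) (i j : 'I_N) :
  psdmx M -> M i j ^+ 2 <= M i i * M j j.
Proof.
move=> psdM; have jj_ge0 := psd_diag_ge0 j psdM.
have [jj0|jjN0] := eqVneq (M j j) 0; last first.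
  have := psd_quad2 i j (M j j) (- M i j) psdM.
  have jj_gt0 : 0 < M j j by rewrite lt_def jjN0.
  set x := M i i; set y := M i j; set z := M j j in jj_gt0 *.
  have -> : z ^+ 2 * x + 2 * z * - y * y + (- y) ^+ 2 * z = z * (x * z - y ^+ 2).
    by ring.
  by rewrite pmulr_rge0 // subr_ge0.
(* A vanishing diagonal entry makes the form affine in the other variable. *)
have := psd_quad2 i j (M i j) (- (M i i + 1)) psdM.
rewrite jj0 !mulr0 addr0.
have ii_ge0 := psd_diag_ge0 i psdM.
set x := M i i in ii_ge0 *; set y := M i j.
have -> : y ^+ 2 * x + 2 * y * - (x + 1) * y = - ((x + 2) * y ^+ 2) by ring.
by rewrite oppr_ge0 pmulr_rle0 //; lra.
Qed.

(** Pivoting on a positive diagonal entry subtracts a rank-one square and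
    leaves a positive semidefinite matrix of smaller rank, since the pivot
    coordinate enters the kernel; hence a Gram representation by as many
    coordinates as the rank. *)
Lemma psd_gram (R : realType) (N r : nat) (M : 'M[R]_N) :
  psdmx M -> (\rank M <= r)%N -> exists V : 'M[R]_(N, r), M = V *m V^T.
Proof.
elim: r M => [|r IHr] M psdM rM.
  by exists 0; rewrite mul0mx; apply/eqP; rewrite -mxrank_eq0 -leqn0.
have [/forallP/= diag0|/forallPn[/= i iiN0]] := boolP [forall i, M i i == 0].
  exists 0; rewrite mul0mx; apply/matrixP=> i j; rewrite mxE.
  have := psd_minor2 i j psdM; rewrite (eqP (diag0 i)) mul0r => h.
  by apply/eqP; rewrite -sqrf_eq0 eq_le h sqr_ge0.
have ii_gt0 : 0 < M i i by rewrite lt_def iiN0 psd_diag_ge0.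
have [/[!symmetricmxE] /eqP symM _] := psdM.
pose s := Num.sqrt (M i i).
have s2 : s ^+ 2 = M i i by rewrite sqr_sqrtr // ltW.
have sN0 : s != 0 by rewrite gt_eqF // sqrtr_gt0.
pose v : 'cV[R]_N := s^-1 *: col i M.
pose T : 'M[R]_N := 1%:M - (M i i)^-1 *: (delta_mx i i *m M).
have rowiM : row i M = (col i M)^T by rewrite tr_col symM.
have dM : (delta_mx i i : 'M[R]_N) *m M = delta_mx i 0 *m row i M.
  by rewrite rowE mulmxA mul_delta_mx.
have vv : v *m v^T = (M i i)^-1 *: (col i M *m row i M).
  by rewrite rowiM /v linearZ /= -scalemxAl -scalemxAr scalerA -expr2 exprVn s2.
have MT : M *m T = M - v *m v^T.
  by rewrite /T mulmxBr mulmx1 -scalemxAr dM mulmxA -colE vv.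
have TTM : T^T *m M = M - v *m v^T.
  have := congr1 trmx MT.
  by rewrite trmx_mul symM [(M - _)^T]linearB /= trmx_mul trmxK symM.
have TMd : M *m T *m (delta_mx i 0 : 'cV_N) = 0.
  rewrite MT mulmxBl vv -scalemxAl -colE -mulmxA.
  have -> : row i M *m (delta_mx i 0 : 'cV_N) = (M i i)%:M.
    by rewrite -colE; apply/matrixP=> a b; rewrite !ord1 !mxE.
  by rewrite mul_mx_scalar scalerA mulVf // scale1r subrr.
have idem : T^T *m M *m T = M *m T.
  rewrite TTM -MT {2}/T mulmxBr mulmx1 -scalemxAr.
  rewrite dM mulmxA TMd mul0mx scaler0 subr0 //.
have psdM' : psdmx (M *m T) by rewrite -idem; apply: psd_congr.
have rM' : (\rank (M *m T) < \rank M)%N.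
  have sub : (M *m T <= M)%MS by rewrite MT -TTM submxMl.
  rewrite ltn_neqAle mxrankS // andbT; apply/negP=> /eqP eqr.
  have : (M *m T == M)%MS by rewrite -(mxrank_leqif_eq sub) eqr.
  case/andP=> _ /submxP[D MD].
  have : M *m (delta_mx i 0 : 'cV_N) = 0 by rewrite MD -mulmxA TMd mulmx0.
  rewrite -colE => /matrixP/(_ i 0); rewrite !mxE => ii0.
  by rewrite ii0 ltxx in ii_gt0.
have [V VE] := IHr _ psdM' (leq_trans rM' rM : (\rank (M *m T) <= r)%N).
have ME : M = row_mx v V *m (row_mx v V)^T.
  by rewrite tr_row_mx mul_row_col -VE MT addrC subrK.
by exists (row_mx v V).
Qed.

(** * Schur complements *)

(** Block elimination writes the Schur complement both as a congruence of the
    block matrix and as one block of an equivalent diagonal matrix. *)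
Lemma schur_complement (R : realType) (m n r : nat) (P : 'M[R]_m)
    (L : 'M[R]_(n, m)) (Q : 'M[R]_n) :
    let M := block_mx P L^T L Q in
    P \in unitmx -> psdmx M -> (\rank M <= m + r)%N ->
  let S := Q - L *m invmx P *m L^T in psdmx S /\ (\rank S <= r)%N.
Proof.
move=> M uP psdM rM S.
have [/[!symmetricmxE] /eqP symM _] := psdM.
have symP : P^T = P.
  by move: symM; rewrite /M tr_block_mx => /eq_block_mx[].
pose W := L *m invmx P.
have WT : W^T = invmx P *m L^T by rewrite trmx_mul trmx_inv symP.
have WP : W *m P = L by rewrite mulmxKV.
split.
  have -> : S = (col_mx (- W^T) 1%:M)^T *m M *m col_mx (- W^T) 1%:M.
    rewrite tr_col_mx linearN /= trmxK trmx1 /M mul_row_block !mul1mx !mulNmx WP.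
    rewrite addNr mul_row_col mul0mx add0r mulmx1 addrC; congr (_ - _).
  exact: psd_congr.
pose E : 'M[R]_(m + n) := block_mx 1%:M 0 (- W) 1%:M.
pose E' : 'M[R]_(m + n) := block_mx 1%:M (- W^T) 0 1%:M.
have EME : E *m M *m E' = block_mx P 0 0 S.
  rewrite /E /M mulmx_block !mul1mx !mul0mx !addr0 !mulNmx WP addNr.
  rewrite mulmx_block !mulmx1 !mulmx0 !mul0mx !addr0 mulmxN add0r.
  rewrite WT mulmxA mulmxV // mul1mx addNr [- _ + _]addrC; congr block_mx.
have : (\rank (block_mx P 0 0 S) <= m + r)%N.
  rewrite -EME; apply: leq_trans rM.
  by apply: leq_trans (mxrankM_maxl _ _) (mxrankM_maxr _ _).
by rewrite rank_diag_block_mx mxrank_unit // leq_add2l.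
Qed.

(** * Nearly orthonormal frames *)

Definition dot (R : realType) (r : nat) (u v : 'rV[R]_r) : R :=
  \sum_l u 0 l * v 0 l.

Lemma dotC (R : realType) (r : nat) (u v : 'rV[R]_r) : dot u v = dot v u.
Proof. by apply: eq_bigr => l _; rewrite mulrC. Qed.

Lemma dot_ge0 (R : realType) (r : nat) (u : 'rV[R]_r) : 0 <= dot u u.
Proof. by apply: sumr_ge0 => l _; rewrite -expr2 sqr_ge0. Qed.

Lemma dotDl (R : realType) (r : nat) (u v w : 'rV[R]_r) :
  dot (u + v) w = dot u w + dot v w.
Proof.
by rewrite /dot -big_split; apply: eq_bigr => l _; rewrite mxE mulrDl.
Qed.

Lemma dotZl (R : realType) (r : nat) (a : R) (u v : 'rV[R]_r) :
  dot (a *: u) v = a * dot u v.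
Proof. by rewrite /dot mulr_sumr; apply: eq_bigr => l _; rewrite mxE mulrA. Qed.

Lemma dotDr (R : realType) (r : nat) (u v w : 'rV[R]_r) :
  dot w (u + v) = dot w u + dot w v.
Proof. by rewrite dotC dotDl !(dotC w). Qed.

Lemma dotZr (R : realType) (r : nat) (a : R) (u v : 'rV[R]_r) :
  dot u (a *: v) = a * dot u v.
Proof. by rewrite dotC dotZl dotC. Qed.

Lemma dot_unit_coord (R : realType) (r : nat) (u : 'rV[R]_r) (l : 'I_r) :
  dot u u = 1 -> `|u 0 l| <= 1.
Proof.
move=> u1; rewrite -(@expr_le1 _ 2) // real_normK ?num_real // -u1.
rewrite /dot (bigD1 l) //= -expr2 lerDl sumr_ge0 // => i _.
by rewrite -expr2 sqr_ge0.
Qed.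

Lemma gram_rowE (R : realType) (N r : nat) (V : 'M[R]_(N, r)) (i j : 'I_N) :
  (V *m V^T) i j = dot (row i V) (row j V).
Proof. by rewrite mxE; apply: eq_bigr => l _; rewrite !mxE. Qed.

Lemma sum_sqr_mxtrace (R : realType) (r : nat) (M : 'M[R]_r) :
  M^T = M -> \sum_i \sum_j M i j ^+ 2 = \tr (M *m M).
Proof.
move=> symM; apply: eq_bigr => i _; rewrite mxE; apply: eq_bigr => j _.
by rewrite expr2 -{2}symM mxE.
Qed.

(** For square Z the defects Z Z^T - 1 and Z^T Z - 1 have the same Frobenius
    norm, both squares being the trace of Z Z^T Z Z^T - 2 Z Z^T + 1.  Hence
    rows that are nearly orthonormal nearly resolve the identity. *)
Lemma defect_trmxC (R : realType) (r : nat) (Z : 'M[R]_r) :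
  \sum_i \sum_j (Z^T *m Z - 1%:M) i j ^+ 2 =
  \sum_i \sum_j (Z *m Z^T - 1%:M) i j ^+ 2.
Proof.
rewrite !sum_sqr_mxtrace; last 2 first.
- by rewrite linearB /= trmx_mul trmxK trmx1.
- by rewrite linearB /= trmx_mul trmxK trmx1.
rewrite !mulmxBl !mulmxBr !mul1mx !mulmx1 !linearB /=.
rewrite [\tr (Z^T *m Z)]mxtrace_mulC; congr (_ - _ - _).
by rewrite -mulmxA mxtrace_mulC !mulmxA.
Qed.

Lemma near_parseval (R : realType) (r : nat) (z : 'I_r -> 'rV[R]_r)
    (x y : 'rV[R]_r) (e : R) :
    (forall l, dot (z l) (z l) = 1) ->
    (forall l l', l != l' -> `|dot (z l) (z l')| <= e) -> 0 <= e ->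
    dot x x = 1 -> dot y y = 1 ->
  `|dot x y - \sum_l dot x (z l) * dot (z l) y| <= r%:R ^+ 3 * e.
Proof.
move=> z1 ze e0 x1 y1.
have sumc (c : R) : \sum_(i < r) c = r%:R * c.
  by rewrite sumr_const card_ord mulr_natl.
pose Z : 'M[R]_r := \matrix_l z l.
pose F := Z^T *m Z - 1%:M.
have F2 : \sum_i \sum_j F i j ^+ 2 <= (r%:R * e) ^+ 2.
  rewrite defect_trmxC.
  apply: (@le_trans _ _ (\sum_(i < r) \sum_(j < r) e ^+ 2)).
    apply: ler_sum => i _; apply: ler_sum => j _.
    rewrite mxE gram_rowE !rowK !mxE; have [<-|ij] := eqVneq i j.
      by rewrite z1 subrr expr0n sqr_ge0.
    by rewrite subr0 -real_normK ?num_real // lerXn2r ?nnegrE ?ze.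
  by rewrite !sumc mulrA exprMn expr2.
have Fe i j : `|F i j| <= r%:R * e.
  rewrite -(@ler_pXn2r _ 2) ?nnegrE ?mulr_ge0 // real_normK ?num_real //.
  apply: le_trans F2; rewrite (bigD1 i) //= (bigD1 j) //= -addrA lerDl.
  rewrite addr_ge0 ?sumr_ge0 // => k _; first exact: sqr_ge0.
  by rewrite sumr_ge0 // => l _; rewrite sqr_ge0.
have -> : dot x y - \sum_l dot x (z l) * dot (z l) y =
    - \sum_i \sum_j x 0 i * F i j * y 0 j.
  have -> : \sum_i \sum_j x 0 i * F i j * y 0 j = (x *m F *m y^T) 0 0.
    rewrite mxE exchange_big; apply: eq_bigr => j _ /=.
    by rewrite [(_ *m _) _ _]mxE mulr_suml; apply: eq_bigr => i _; rewrite !mxE.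
  rewrite mulmxBr mulmx1 mulmxBl mulmxA -mulmxA !mxE opprB; congr (_ - _).
    by apply: eq_bigr => l _; rewrite mxE.
  apply: eq_bigr => l _; rewrite !mxE; congr (_ * _); apply: eq_bigr => i _;
  by rewrite !mxE.
rewrite normrN.
apply: (@le_trans _ _ (\sum_(i < r) \sum_(j < r) r%:R * e)); last first.
  by rewrite !sumc !mulrA -expr2 -exprSr.
apply: le_trans (ler_norm_sum _ _ _) _; apply: ler_sum => i _.
apply: le_trans (ler_norm_sum _ _ _) _; apply: ler_sum => j _.
rewrite !normrM -[leRHS]mul1r -[leRHS]mulr1.
by rewrite !ler_pM ?mulr_ge0 ?dot_unit_coord.
Qed.

Lemma near_parseval3 (R : realType) (u v w x y : 'rV[R]_3) (e : R) :
    [/\ dot u u = 1, dot v v = 1 & dot w w = 1] ->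
    [/\ `|dot u v| <= e, `|dot u w| <= e & `|dot v w| <= e] ->
    dot x x = 1 -> dot y y = 1 ->
  `|dot x y - (dot x u * dot u y + dot x v * dot v y + dot x w * dot w y)|
     <= 27 * e.
Proof.
move=> [u1 v1 w1] [uv uw vw] x1 y1.
have e0 : 0 <= e by apply: le_trans uv.
pose z : 'I_3 -> 'rV[R]_3 := tnth [tuple u; v; w].
have z1 l : dot (z l) (z l) = 1.
  by case: l => -[|[|[|l]]] //= h; rewrite /z (tnth_nth 0).
have ze l l' : l != l' -> `|dot (z l) (z l')| <= e.
  case: l => -[|[|[|l]]] //= h; case: l' => -[|[|[|l']]] //= h' _;
  by rewrite /z !(tnth_nth 0) //= dotC.
have := near_parseval z1 ze e0 x1 y1.
rewrite !big_ord_recl big_ord0 /= addr0 addrA /z !(tnth_nth 0) /=.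
by congr (_ <= _ * _); ring.
Qed.

Lemma dot_unit_le1 (R : realType) (r : nat) (u v : 'rV[R]_r) :
  dot u u = 1 -> dot v v = 1 -> `|dot u v| <= 1.
Proof.
move=> u1 v1; have := dot_ge0 (u + v); have := dot_ge0 (u + (-1) *: v).
rewrite !(dotDl, dotDr, dotZl, dotZr) u1 v1 (dotC v u) => h1 h2.
by rewrite ler_norml; apply/andP; split; lra.
Qed.

(** Bessel's inequality for two vectors: it is the nonnegativity of the square
    of <x,w> x + <y,w> y - w. *)
Lemma bessel2 (R : realType) (r : nat) (x y w : 'rV[R]_r) :
    dot x x = 1 -> dot y y = 1 -> dot w w = 1 ->
  (dot x w ^+ 2 + dot y w ^+ 2) * (1 - `|dot x y|) <= 1.
Proof.
move=> x1 y1 w1; have := dot_ge0 (dot x w *: x + dot y w *: y + (-1) *: w).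
rewrite !(dotDl, dotDr, dotZl, dotZr) x1 y1 w1 (dotC y x) (dotC w x) (dotC w y).
set s := dot x w; set t := dot y w; set p := dot x y => h.
have st : s * t * p <= (s ^+ 2 + t ^+ 2) / 2 * `|p|.
  apply: le_trans (ler_norm _) _; rewrite normrM ler_wpM2r //.
  by rewrite ler_norml; apply/andP; split; have := sqr_ge0 (s + t);
    have := sqr_ge0 (s - t); lra.
by lra.
Qed.

(** * The Peeters gadget *)

(** With tolerance 0, i, a, b and j, c, d are orthonormal frames: expanding
    <j,c> = 0 in the first one leaves <i,j> <i,c> = 0, and expanding <i,i> = 1 in
    the second one leaves <i,c>^2 = 1 - <i,j>^2, so <i,j> is 0, 1 or -1.  The
    tolerance perturbs both expansions by a small multiple of itself. *)
Lemma gadget_near_dichotomy (R : realType) (i a b j c d : 'rV[R]_3) :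
    [/\ dot i i = 1, dot a a = 1 & dot b b = 1] ->
    [/\ dot j j = 1, dot c c = 1 & dot d d = 1] ->
    [/\ `|dot i a| <= 10 ^- 8, `|dot i b| <= 10 ^- 8 & `|dot a b| <= 10 ^- 8] ->
    [/\ `|dot j c| <= 10 ^- 8, `|dot j d| <= 10 ^- 8 & `|dot c d| <= 10 ^- 8] ->
    [/\ `|dot a j| <= 10 ^- 8, `|dot i d| <= 10 ^- 8 & `|dot b c| <= 10 ^- 8] ->
  dot i j ^+ 2 <= 10 ^- 5 \/ 1 - 10 ^- 5 <= dot i j ^+ 2.
Proof.
move=> iab1 jcd1 iab jcd [aj id bc].
have [i1 a1 b1] := iab1; have [j1 c1 d1] := jcd1.
have [_ _ _] := iab; have [jc _ _] := jcd.
have h1 := near_parseval3 jcd1 jcd i1 i1.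
have h2 := near_parseval3 iab1 iab j1 c1.
have := dot_unit_le1 i1 j1; have := dot_unit_le1 j1 b1; have := dot_unit_le1 a1 c1.
move: h1 h2 aj id bc jc.
rewrite (dotC j i) (dotC j a) (dotC j b) (dotC c i) (dotC d i).
set e : R := 10 ^- 8.
have e_gt0 : 0 < e by rewrite invr_gt0 exprn_gt0.
have [e8 e5] : e * 10 ^+ 8 = 1 /\ 10 ^- 5 = e * 1000.
  by rewrite /e; split; field.
rewrite e5; clearbody e; set t := dot i j; set x := dot i c; set y := dot i d.
set p := dot j c; set aj := dot a j; set ac := dot a c; set jb := dot b j.
set bc := dot b c; move=> h1 h2 haj hy hbc hp hac hjb ht.
have prod_le (u v : R) : `|u| <= e -> `|v| <= 1 -> `|u * v| <= e.
  by move=> hu hv; rewrite normrM -[leRHS]mulr1 ler_pM.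
(* Parseval for <j,c> costs 27 e, and three near-orthogonalities e each. *)
have tx_le : `|t * x| <= 30 * e.
  have := prod_le _ _ haj hac; have := prod_le _ _ hbc hjb.
  move: h2 hp; rewrite (mulrC jb) !ler_norml.
  by move=> /andP[? ?] /andP[? ?] /andP[? ?] /andP[? ?]; apply/andP; split; lra.
have sq_le (u v : R) : 0 <= v -> `|u| <= v -> u ^+ 2 <= v ^+ 2.
  by move=> v0 hu; rewrite -real_normK ?num_real // lerXn2r ?nnegrE.
have tx2 : t ^+ 2 * x ^+ 2 <= 900 * e ^+ 2.
  have e30 : 0 <= 30 * e by lra.
  have := sq_le _ _ e30 tx_le; rewrite exprMn.
  by have -> : (30 * e) ^+ 2 = 900 * e ^+ 2 by ring.
have y2 := sq_le _ _ (ltW e_gt0) hy.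
have t2 := sq_le _ _ ler01 ht; rewrite expr1n in t2.
have e2 : e ^+ 2 * 10 ^+ 8 = e by rewrite expr2 -mulrA e8 mulr1.
have x2 : 1 - t ^+ 2 - 28 * e <= x ^+ 2.
  by move: h1; rewrite i1 ler_norml -!expr2 => /andP[_ ?]; lra.
have t2_ge0 := sqr_ge0 t.
have small : t ^+ 2 * (1 - t ^+ 2) <= 29 * e.
  have : t ^+ 2 * (1 - t ^+ 2 - 28 * e) <= t ^+ 2 * x ^+ 2 by rewrite ler_wpM2l.
  have : t ^+ 2 * e <= e by rewrite ler_piMl // ltW.
  by lra.
(* t^2 (1 - t^2) <= 29 e keeps t^2 within about 29 e of 0 or 1. *)
case: (lerP (t ^+ 2) (e * 1000)) => [|lo]; first by left.
case: (lerP (1 - e * 1000) (t ^+ 2)) => [|hi]; first by right.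
have : 0 < (t ^+ 2 - e * 1000) * (1 - e * 1000 - t ^+ 2).
  by rewrite mulr_gt0 // subr_gt0.
by nra.
Qed.

(** * Colourings of the supergraph *)

(** The supergraph forces any two original vertices to be nearly parallel or
    nearly orthogonal.  A largest set of pairwise non-parallel vertices has at
    most three elements, because by near-Parseval a fourth vector would have
    almost zero length; colour each vertex by a member of this set parallel to
    it.  By Bessel's inequality nearly orthogonal vertices are not both
    parallel to the same member. *)
Lemma peeters_near_rep_colorable (R : realType) (G : sgraph)
    (z : peeters G -> 'rV[R]_3) :
    (forall x, dot (z x) (z x) = 1) ->
    (forall x y, adj x y -> `|dot (z x) (z y)| <= 10 ^- 8) ->
  colorable 3 G.
Proof.
move=> z1 ze.
(* Any threshold between 10^-5 and 1 - 10^-5 separates the two alternatives. *)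
pose par (x y : G) := 2^-1 < dot (z (inl x)) (z (inl y)) ^+ 2.
have par_refl x : par x x by rewrite /par z1 expr1n; lra.
have gadget_adj (p : dpairs G) u v :
    (u, v) \in gadget p -> `|dot (z u) (z v)| <= 10 ^- 8.
  move=> uv; apply: ze; apply/orP; right; apply/existsP; exists p.
  by rewrite uv.
have dich_lt x y : (enum_rank x < enum_rank y)%N ->
    dot (z (inl x)) (z (inl y)) ^+ 2 <= 10 ^- 5 \/
    1 - 10 ^- 5 <= dot (z (inl x)) (z (inl y)) ^+ 2.
  move=> xy; pose p : dpairs G := exist _ (x, y) xy.
  pose new k : peeters G := inr (p, k).
  have near u v := @gadget_adj p u v.
  apply: (@gadget_near_dichotomy _ _ (z (new (@Ordinal 4 0 isT)))
    (z (new (@Ordinal 4 1 isT))) _ (z (new (@Ordinal 4 2 isT)))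
    (z (new (@Ordinal 4 3 isT)))); split; rewrite ?z1 //; apply: near;
    by rewrite !inE eqxx ?orbT.
have tol5 : (10 : R) ^- 5 * 10 ^+ 5 = 1 by field.
have dich x y : x != y -> dot (z (inl x)) (z (inl y)) ^+ 2 <= 10 ^- 5 \/
    1 - 10 ^- 5 <= dot (z (inl x)) (z (inl y)) ^+ 2.
  rewrite -(inj_eq enum_rank_inj) neq_ltn => /orP[] /dich_lt //.
  by rewrite dotC.
have npar_small x y : x != y -> ~~ par x y -> `|dot (z (inl x)) (z (inl y))| <= 300^-1.
  move=> /dich xy; rewrite /par -leNgt => npar.
  rewrite -(@ler_pXn2r _ 2) ?nnegrE ?invr_ge0 // real_normK ?num_real //.
  have : (300 : R)^-1 ^+ 2 * 300 ^+ 2 = 1 by field.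
  by case: xy; lra.
have par_large x y : par x y -> 1 - 10 ^- 5 <= dot (z (inl x)) (z (inl y)) ^+ 2.
  have [<- _|/dich[]//] := eqVneq x y; first by rewrite z1 expr1n; lra.
  by rewrite /par; lra.
pose indep (s : {set G}) :=
  [forall x in s, forall y in s, (x != y) ==> ~~ par x y].
have indep0 : indep set0 by apply/forall_inP=> x; rewrite inE.
case: (@arg_maxnP _ set0 indep (fun s : {set G} => #|s|) indep0) => s s_ind s_max.
have sP x y : x \in s -> y \in s -> x != y -> ~~ par x y.
  by move=> xs ys; move/forall_inP: s_ind => /(_ _ xs)/forall_inP/(_ _ ys)/implyP.
have s_dom x : exists2 w, w \in s & par x w.
  have [xs|xs] := boolP (x \in s); first by exists x.
  apply/exists_inP; apply: contraT; rewrite negb_exists_in => /forall_inP npar.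
  have : indep (x |: s).
    apply/forall_inP=> u /setU1P[->|us]; apply/forall_inP=> v /setU1P[->|vs];
      apply/implyP; rewrite ?eqxx //.
    - by move=> _; apply: npar.
    - by move=> _; rewrite /par dotC; apply: npar.
    - exact: sP.
  by move/s_max; rewrite cardsU1 xs /= add1n ltnn.
have s3 : (#|s| <= 3)%N.
  rewrite leqNgt cardE; apply/negP=> s4.
  have [x0 _] : exists x0, x0 \in s.
    by apply/set0Pn; rewrite -card_gt0 cardE; apply: leq_trans s4.
  pose w k := nth x0 (enum s) k.
  have w_orth k l : (k < 4)%N -> (l < 4)%N -> k != l ->
      `|dot (z (inl (w k))) (z (inl (w l)))| <= 300^-1.
    move=> k4 l4 kl; have ks := leq_trans k4 s4; have ls := leq_trans l4 s4.
    have wkl : w k != w l by rewrite nth_uniq ?enum_uniq.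
    by apply: npar_small => //; apply: sP => //; rewrite -mem_enum mem_nth.
  (* The three squares and the Parseval error 27/300 stay below 1 = |w 3|^2. *)
  have := @near_parseval3 _ (z (inl (w 0%N))) (z (inl (w 1%N))) (z (inl (w 2%N)))
    (z (inl (w 3%N))) (z (inl (w 3%N))) 300^-1.
  rewrite !z1 => /(_ (And3 erefl erefl erefl)).
  have [o01 o02 o12] :=
    And3 (w_orth 0 1 isT isT isT) (w_orth 0 2 isT isT isT) (w_orth 1 2 isT isT isT).
  move=> /(_ (And3 o01 o02 o12) erefl erefl).
  have sq_small k : (k < 3)%N ->
      dot (z (inl (w 3%N))) (z (inl (w k))) * dot (z (inl (w k))) (z (inl (w 3%N))) <= 300^-1 * 1.
    move=> k3; rewrite (dotC (z (inl (w k)))) -expr2 -real_normK ?num_real // expr2.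
    have k_orth := w_orth 3 k isT (ltnW k3) _.
    by rewrite ler_pM ?dot_unit_le1 // k_orth // gtn_eqF.
  have := sq_small 0 isT; have := sq_small 1 isT; have := sq_small 2 isT.
  by move=> h2 h1 h0; rewrite ler_norml => /andP[_]; lra.
pose rep x := odflt x [pick w in s | par x w].
have repP x : rep x \in s /\ par x (rep x).
  rewrite /rep; case: pickP => [w /andP[]//|nw].
  by have [w ws xw] := s_dom x; have := nw w; rewrite /= ws xw.
have index_lt x : (index (rep x) (enum s) < 3)%N.
  by apply: leq_trans s3; rewrite cardE index_mem mem_enum; case: (repP x).
exists (fun x => Ordinal (index_lt x)) => x y xy.
apply/negP=> /eqP[same]; have [xs px] := repP x; have [ys py] := repP y.
have rxy : rep x = rep y.
  by rewrite -(nth_index x (_ : rep x \in enum s)) ?mem_enum // same nth_index ?mem_enum.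
have := bessel2 (z1 (inl x)) (z1 (inl y)) (z1 (inl (rep x))).
have : `|dot (z (inl x)) (z (inl y))| <= 10 ^- 8.
  by apply: ze; rewrite /= /peeters_adj xy.
move: (par_large _ _ px) (par_large _ _ py); rewrite -rxy.
set A := dot _ _ ^+ 2; set B := dot _ _ ^+ 2; set p := `|_| => hA hB hp.
have : (10 : R) ^- 8 * 10 ^+ 8 = 1 by field.
have : (A + B) * p <= 10 ^- 8 * 2.
  have sq1 u v : dot (z u) (z v) ^+ 2 <= 1.
    by rewrite -real_normK ?num_real // expr_le1 ?dot_unit_le1.
  have p_ge0 : 0 <= p by apply: normr_ge0.
  rewrite mulrC ler_pM ?addr_ge0 ?sqr_ge0 //.
  have := sq1 (inl x) (inl (rep x)); have := sq1 (inl y) (inl (rep x)).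
  by rewrite -/A -/B; lra.
by lra.
Qed.

(** When the endpoints share a colour the triangles are completed by the two
    other colours; otherwise a and d take the third colour and b and c copy the
    colour of the opposite endpoint. *)
Definition gadget_color (x y : 'I_3) (l : 'I_4) : 'I_3 :=
  if x == y then nth x [:: x + 1; x + 2; x + 1; x + 2] l
  else nth x [:: - (x + y); y; x; - (x + y)] l.

Lemma peeters_colorable (G : sgraph) : colorable 3 G -> colorable 3 (peeters G).
Proof.
case=> c c_proper.
pose c' (v : peeters G) : 'I_3 := match v with
  | inl x => c x
  | inr (p, l) => gadget_color (c (val p).1) (c (val p).2) l
  end.
have gadget_proper (p : dpairs G) u v : (u, v) \in gadget p -> c' u != c' v.
  rewrite /gadget !inE /gadget_color.
  do ![case/orP]; move/eqP=> -[-> ->] /=; rewrite /gadget_color;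
  case: (c (val p).1) => -[|[|[|x]]] //= hx;
  by case: (c (val p).2) => -[|[|[|y]]] //= hy.
exists c' => u v /orP[|/existsP[p /orP[]]].
- by case: u v => [u|u] [v|v] //; apply: c_proper.
- exact: gadget_proper.
- by rewrite eq_sym; apply: gadget_proper.
Qed.

(** * Incidence matrices *)

Lemma edgesP (G : sgraph) (e : {set G}) :
  reflect (exists x y, adj x y /\ e = [set x; y]) (e \in edges G).
Proof.
apply: (iffP imsetP) => [[[x y] xy ->]|[x [y [xy ->]]]].
  by exists x, y; split=> //; rewrite inE in xy.
by exists (x, y); rewrite ?inE.
Qed.

Lemma mem_edges2 (G : sgraph) (x y : G) : ([set x; y] \in edges G) = adj x y.
Proof.
apply/edgesP/idP => [[u [v [uv /setP E]]]|xy]; last by exists x, y.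
have uNv : u != v by apply/eqP=> eq_uv; rewrite eq_uv adj_irr in uv.
move: (E x) (E y) (E u) (E v); rewrite !inE !eqxx ?orbT /=.
do 2!(move/esym/orP => [] /eqP ->); rewrite // 1?[adj v u]adj_sym //.
  by rewrite !orbb eq_sym (negPf uNv).
by rewrite !orbb => /esym; rewrite (negPf uNv).
Qed.

Lemma edge_eq2 (G : sgraph) (e : {set G}) (x y : G) :
  e \in edges G -> x != y -> x \in e -> y \in e -> e = [set x; y].
Proof.
move=> /edgesP[u [v [_ ->]]] xy; rewrite !inE => /orP[]/eqP xE /orP[]/eqP yE;
  by rewrite xE yE ?eqxx // in xy *; rewrite setUC.
Qed.

Lemma incidence_mul0 (R : realType) (G : sgraph) (i j : 'I_#|G|) e :
    i != j -> ~~ adj (enum_val i : G) (enum_val j) ->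
  incidence_mx R G i e * incidence_mx R G j e = 0.
Proof.
move=> ij nadj; rewrite !mxE.
have xy : (enum_val i : G) != enum_val j by rewrite (inj_eq enum_val_inj).
have [xe|] := boolP (enum_val i \in _); last by rewrite mul0r.
have [ye|] := boolP (enum_val j \in _); last by rewrite mulr0.
have eE := enum_valP e.
by move: (eE); rewrite (edge_eq2 eE xy xe ye) mem_edges2 (negPf nadj).
Qed.

Lemma incidence_quad (R : realType) (G : sgraph) (w : {set G} -> R) (i j : 'I_#|G|) :
    i != j ->
  \sum_e incidence_mx R G i e * w (enum_val e) * incidence_mx R G j e =
  if adj (enum_val i : G) (enum_val j) then w [set enum_val i; enum_val j] else 0.
Proof.
move=> ij; set x : G := enum_val i; set y : G := enum_val j.
have xy : x != y by rewrite (inj_eq enum_val_inj).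
case: ifPn => xy_adj; last first.
  by rewrite big1 // => e _; rewrite mulrAC incidence_mul0 ?mul0r.
under eq_bigr do rewrite !mxE -/x -/y.
rewrite -(big_enum_val (fun e : {set G} => (x \in e)%:R * w e * (y \in e)%:R)) /=.
have exy : [set x; y] \in edges G by rewrite mem_edges2.
rewrite (bigD1 _ exy) /= !inE !eqxx orbT mulr1 mul1r big1 ?addr0 // => e /andP[eE].
have [xe|] := boolP (x \in e); last by rewrite !mul0r.
have [ye|] := boolP (y \in e); last by rewrite mulr0.
by rewrite (edge_eq2 eE xy xe ye) eqxx.
Qed.

Lemma incidence_degree (R : realType) (G : sgraph) (i : 'I_#|G|) :
  \sum_e incidence_mx R G i e <= (degree (enum_val i : G))%:R.
Proof.
under eq_bigr do rewrite mxE.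
set x : G := enum_val i.
rewrite -(big_enum_val (fun e : {set G} => (x \in e)%:R : R)) /= -natr_sum ler_nat.
have -> : (\sum_(e in edges G) (x \in e) = #|[set e in edges G | x \in e]|)%N.
  by rewrite -sum1dep_card big_mkcondr; apply: eq_bigr => e _; case: (x \in e).
apply: leq_trans (leq_imset_card (fun y => [set x; y]) [set y | adj x y]).
apply/subset_leq_card/subsetP => e; rewrite !inE => /andP[/edgesP[u [v [uv ->]]]].
rewrite !inE => /orP[]/eqP xE; move: uv; rewrite -xE => xuv.
  by apply/imsetP; exists v; rewrite ?inE.
by apply/imsetP; exists u; rewrite ?inE 1?adj_sym // setUC.
Qed.

Lemma edge_has_end (R : realType) (G : sgraph) (e : 'I_#|edges G|) :
  exists i, incidence_mx R G i e = 1.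
Proof.
have /edgesP[x [y [_ E]]] := enum_valP e.
by exists (enum_rank x); rewrite mxE enum_rankK E !inE eqxx.
Qed.

(** * From colourings to low rank *)

Lemma p1_B_sub_diag (R : realType) (G : sgraph) (d : 'rV[R]_(p1_m G + p1_n G)) :
  let K := incidence_mx R (p1_graph G) in
  p1_B R G - diag_mx d =
    block_mx (diag_mx (\row_e ((p1_k G)%:R - d 0 (lshift _ e)))) K^T
             K (p1_A R G + (p1_k G)%:R%:M - diag_mx (rsubmx d)).
Proof.
move=> K; rewrite /p1_B scalar_mx_block add_block_mx -[d in LHS]hsubmxK diag_mx_row /=.
rewrite opp_block_mx add_block_mx !addr0 !subr0 add0r; congr block_mx.
by apply/matrixP=> i j; rewrite !mxE mulrnBl.
Qed.

(** Choose the Schur complement to be the Gram matrix of the unit vectors that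
    a 3-colouring of the supergraph prescribes.  Its entry at two nonadjacent
    parents is 1 or 0 whereas A has a 2 there, so the edge of the
    index graph must contribute the weight 1 or 2, which its diagonal entry in
    the leading block, the inverse of this weight, does.  The trailing diagonal
    absorbs the rest: k is large enough for the weights at any index. *)
Lemma p1_low_rank (R : realType) (G : sgraph) :
  colorable 3 G ->
  exists d : 'rV[R]_(p1_m G + p1_n G),
    [/\ forall j, 0 <= d 0 j, psdmx (p1_B R G - diag_mx d) &
        (\rank (p1_B R G - diag_mx d)%R <= p1_m G + 3)%N].
Proof.
case/peeters_colorable => c c_proper.
pose n := p1_n G; pose m := p1_m G; pose k : R := (p1_k G)%:R.
pose K : 'M[R]_(n, m) := incidence_mx R (p1_graph G).
pose mono (e : {set p1_graph G}) := [forall u in e, forall v in e, c u.1 == c v.1].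
pose w e : R := if mono e then 1 else 2.
have w_bounds e : 1 <= w e <= 2 by rewrite /w; case: (mono e); apply/andP; split; lra.
have w_gt0 e : 0 < w e by case/andP: (w_bounds e); lra.
pose W : 'M[R]_(n, 3) :=
  \matrix_(i, l) (c (enum_val i : p1_graph G).1 == l)%:R.
have WW i j : (W *m W^T) i j =
    (c (enum_val i : p1_graph G).1 == c (enum_val j : p1_graph G).1)%:R.
  rewrite mxE (bigD1 (c (enum_val i : p1_graph G).1)) //= !mxE eqxx mul1r.
  rewrite [_ == c _ in LHS]eq_sym big1 ?addr0 // => l lN; rewrite !mxE.
  by rewrite [_ == l]eq_sym (negPf lN) mul0r.
have [s [s2 s_neq0]] : exists s : 'rV[R]_m,
    (forall e, s 0 e ^+ 2 = w (enum_val e)) /\ (forall e, s 0 e != 0).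
  exists (\row_e Num.sqrt (w (enum_val e))).
  by split=> e; rewrite mxE ?sqr_sqrtr ?ltW // gt_eqF // sqrtr_gt0.
pose F : 'M[R]_(m + n, m + 3) :=
  block_mx (diag_mx (\row_e (s 0 e)^-1)) 0 (K *m diag_mx s) W.
pose load i : R := \sum_e K i e * w (enum_val e).
pose d : 'rV[R]_(m + n) :=
  row_mx (\row_e (k - (w (enum_val e))^-1)) (\row_i (k - load i - 1)).
have k_deg (i : 'I_n) : 2 * (degree (enum_val i : p1_graph G))%:R + 1 <= k.
  rewrite /k /p1_k natrD natrM lerD2r ler_pM2l // ler_nat.
  exact: (leq_bigmax (enum_val i)).
have load_le i : load i <= 2 * (degree (enum_val i : p1_graph G))%:R.
  apply: le_trans (_ : 2 * \sum_e K i e <= _); last first.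
    by rewrite ler_pM2l // incidence_degree.
  rewrite mulr_sumr; apply: ler_sum => e _; rewrite mulrC ler_wpM2r //.
    by rewrite mxE ler0n.
  by case/andP: (w_bounds (enum_val e)).
have d0 : forall j, 0 <= d 0 j.
  move=> j; rewrite /d; case: (split_ordP j) => i ->.
    rewrite row_mxEl mxE subr_ge0; apply: (@le_trans _ _ 1).
      by rewrite invf_le1 //; case/andP: (w_bounds (enum_val i)).
    by rewrite ler1n /p1_k addn1.
  by rewrite row_mxEr mxE; have := load_le i; have := k_deg i; lra.
have BE : p1_B R G - diag_mx d = F *m F^T.
  rewrite p1_B_sub_diag /F tr_block_mx mulmx_block trmx0 !mul0mx !mulmx0 !addr0.
  rewrite trmx_mul !tr_diag_mx.
  congr block_mx.
  - rewrite mulmx_diag; congr diag_mx; apply/rowP=> e.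
    by rewrite [LHS]mxE row_mxEl [in LHS]mxE -/k subKr !mxE -expr2 exprVn s2.
  - rewrite mulmxA mulmx_diag [X in diag_mx X](_ : _ = const_mx 1).
      by rewrite diag_const_mx mul1mx.
    by apply/rowP=> e; rewrite !mxE mulVf.
  - rewrite -mulmxA mulmx_diag [X in diag_mx X](_ : _ = const_mx 1).
      by rewrite diag_const_mx mulmx1.
    by apply/rowP=> e; rewrite !mxE mulfV.
  apply/matrixP=> i j.
  have -> : (K *m diag_mx s *m (diag_mx s *m K^T) + W *m W^T) i j =
      \sum_e K i e * w (enum_val e) * K j e + (W *m W^T) i j.
    rewrite mxE; congr (_ + _); rewrite mulmxA -[_ *m diag_mx s *m diag_mx s]mulmxA.
    rewrite mulmx_diag mul_mx_diag mxE; apply: eq_bigr => e _; rewrite !mxE.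
    by rewrite -expr2 s2.
  rewrite WW row_mxKr !mxE.
  have [<-|ij] := eqVneq i j.
    rewrite /nonedge adj_irr !eqxx /= !mulr1n add0r.
    have -> : (p1_k G)%:R - (k - load i - 1) = load i + 1 by rewrite /k; ring.
    congr (_ + _); apply: eq_bigr => e _.
    by rewrite mulrAC mxE; case: (_ \in _); rewrite ?mulr1 ?mulr0 ?mul0r.
  rewrite !mulr0n subr0 addr0 incidence_quad // /=.
  set u : p1_graph G := enum_val i; set v : p1_graph G := enum_val j.
  have uv : u != v by rewrite (inj_eq enum_val_inj).
  have monoE : mono [set u; v] = (c u.1 == c v.1).
    apply/forall_inP/idP => [h|/eqP same x].
      by move/forall_inP: (h u (set21 u v)) => /(_ v (set22 u v)).
    rewrite !inE => /orP[]/eqP ->; apply/forall_inP=> y; rewrite !inE => /orP[]/eqP ->;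
    by rewrite ?same.
  rewrite -/(p1_adj u v); case: ifP => uv_adj.
    by rewrite /w monoE; case: eqP => _ /=; lra.
  have := uv_adj; rewrite /p1_adj /nonedge; have [-> _|uv1 /=] := eqVneq u.1 v.1.
    by rewrite peeters_adj_irr uv eqxx add0r.
  by move/negbFE=> uv1_adj; rewrite uv1_adj add0r (negPf (c_proper _ _ uv1_adj)).
by exists d; split; rewrite // BE; [apply: psd_mulmx_tr|apply: mulmx_max_rank].
Qed.

(** * Perturbed Schur complements *)

(** Look at the largest coordinate of x: there the diagonal term dominates the
    whole off-diagonal contribution by a factor two. *)
Lemma near_diag_solve_le (R : realType) (m : nat) (c : 'rV[R]_m) (E : 'M[R]_m)
    (g e b : R) (x : 'cV[R]_m) :
    0 < g -> (forall i, g <= c 0 i) -> (forall i j, `|E i j| <= e) ->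
    2 * m%:R * e <= g -> (forall i, `|((diag_mx c + E) *m x) i 0| <= b) ->
  forall i, `|x i 0| <= 2 * b / g.
Proof.
move=> g0 cg Ee mg bx i0.
case: (@arg_maxP _ R _ i0 predT (fun i => `|x i 0|) isT) => i _ i_max'.
have i_max j : `|x j 0| <= `|x i 0| := i_max' j isT.
apply: le_trans (i_max i0) _; rewrite ler_pdivlMr //.
have Ex : `|(E *m x) i 0| <= m%:R * e * `|x i 0|.
  rewrite mxE; apply: le_trans (ler_norm_sum _ _ _) _.
  apply: le_trans (_ : \sum_(j < m) e * `|x i 0| <= _).
    by apply: ler_sum => j _; rewrite normrM ler_pM // i_max.
  by rewrite sumr_const card_ord -mulrA mulr_natl.
have cx : c 0 i * `|x i 0| <= b + `|(E *m x) i 0|.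
  have -> : c 0 i * `|x i 0| = `|((diag_mx c + E) *m x) i 0 - (E *m x) i 0|.
    rewrite mulmxDl mul_diag_mx !mxE addrK normrM ger0_norm //.
    exact: le_trans (ltW g0) (cg i).
  by apply: le_trans (ler_normB _ _) _; rewrite lerD2r bx.
have := ler_wpM2r (normr_ge0 (x i 0)) (cg i).
have := ler_wpM2r (normr_ge0 (x i 0)) mg.
by lra.
Qed.

Lemma near_diag_unitmx (R : realType) (m : nat) (c : 'rV[R]_m) (E : 'M[R]_m)
    (g e : R) :
    0 < g -> (forall i, g <= c 0 i) -> (forall i j, `|E i j| <= e) ->
    2 * m%:R * e <= g ->
  diag_mx c + E \in unitmx.
Proof.
move=> g0 cg Ee mg; rewrite -unitmx_tr unitmxE unitfE.
apply/det0P=> -[v vN0 vP]; case/negP: vN0; apply/eqP/rowP=> i.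
have Pv0 : (diag_mx c + E) *m v^T = 0.
  by rewrite -[diag_mx c + E]trmxK -trmx_mul vP trmx0.
have := near_diag_solve_le (b := 0) (x := v^T) g0 cg Ee mg _ i.
rewrite Pv0 mulr0 mul0r !mxE normr_le0 => h; apply/eqP/h => j.
by rewrite mxE normr0.
Qed.

(** The columns of the inverse solve equations with right-hand sides bounded by
    1, which bounds its entries; substituting this into C Q + E Q = 1 compares
    Q with the inverse of C. *)
Lemma near_diag_invmx (R : realType) (m : nat) (c : 'rV[R]_m) (E : 'M[R]_m)
    (g e : R) :
    0 < g -> (forall i, g <= c 0 i) -> (forall i j, `|E i j| <= e) ->
    2 * m%:R * e <= g ->
  let Q := invmx (diag_mx c + E) in
  forall i j, `|Q i j| <= 2 / g /\
    `|Q i j - diag_mx (\row_l (c 0 l)^-1) i j| <= 2 * m%:R * e / g ^+ 2.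
Proof.
move=> g0 cg Ee mg Q.
have uP := near_diag_unitmx g0 cg Ee mg.
have PQ : (diag_mx c + E) *m Q = 1%:M by rewrite mulmxV.
have Q_le i j : `|Q i j| <= 2 / g.
  have -> : Q i j = (col j Q) i 0 by rewrite mxE.
  rewrite -[2]mulr1; apply: near_diag_solve_le => // l.
  rewrite colE mulmxA PQ mul1mx !mxE eqxx andbT.
  by case: eqP => _; rewrite ?normr1 ?normr0.
move=> i j; split=> //.
have ci : 0 < c 0 i := lt_le_trans g0 (cg i).
have -> : Q i j - diag_mx (\row_l (c 0 l)^-1) i j = - (c 0 i)^-1 * (E *m Q) i j.
  have : c 0 i * Q i j + (E *m Q) i j = (i == j)%:R.
    have := congr1 (fun M : 'M[R]_m => M i j) PQ.
    by rewrite mulmxDl mul_diag_mx !mxE.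
  move=> /(canRL (addrK _)) /(canRL (mulKf (lt0r_neq0 ci))) ->.
  by rewrite !mxE -mulr_natr; ring.
have EQ : `|(E *m Q) i j| <= m%:R * (e * (2 / g)).
  rewrite mxE; apply: le_trans (ler_norm_sum _ _ _) _.
  apply: le_trans (_ : \sum_(l < m) e * (2 / g) <= _).
    by apply: ler_sum => l _; rewrite normrM ler_pM.
  by rewrite sumr_const card_ord -[_ *+ m]mulr_natl.
rewrite mulNr normrN normrM gtr0_norm ?invr_gt0 //.
have -> : 2 * m%:R * e / g ^+ 2 = g^-1 * (m%:R * (e * (2 / g))).
  by field; exact: lt0r_neq0.
by rewrite ler_pM ?invr_ge0 ?(ltW ci) // lef_pV2 ?posrE.
Qed.

(** Expand both sides as double sums over the m^2 pairs of edges and replace the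
    three factors one at a time; each pair contributes at most
    5 e / g + 4 m e / g^2. *)
Lemma schur_term_perturbation (R : realType) (m n : nat) (c : 'rV[R]_m)
    (E : 'M[R]_m) (K D : 'M[R]_(n, m)) (g e : R) :
    0 < g -> g <= 1 -> e <= 1 -> 2 * m%:R * e <= g ->
    (forall i, g <= c 0 i) -> (forall i j, `|E i j| <= e) ->
    (forall i j, `|K i j| <= 1) -> (forall i j, `|D i j| <= e) ->
  forall u v,
    `|((K + D) *m invmx (diag_mx c + E) *m (K + D)^T) u v
      - (K *m diag_mx (\row_l (c 0 l)^-1) *m K^T) u v|
    <= 9 * m%:R ^+ 3 * e / g ^+ 2.
Proof.
move=> g0 g1 e1 mg cg Ee K1 De u v.
set Q := invmx _; set C := diag_mx _.
have dbl (L : 'M[R]_(n, m)) (M : 'M[R]_m) :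
    (L *m M *m L^T) u v = \sum_j \sum_i L u i * M i j * L v j.
  rewrite mxE; apply: eq_bigr => j _; rewrite !mxE mulr_suml.
  by apply: eq_bigr.
have QC := near_diag_invmx g0 cg Ee mg.
rewrite !dbl -sumrB; apply: le_trans (ler_norm_sum _ _ _) _.
pose b := 9 * m%:R * e / g ^+ 2.
apply: le_trans (_ : \sum_(j < m) \sum_(i < m) b <= _); last first.
  rewrite !sumr_const card_ord -mulrnA -[_ *+ (m * m)]mulr_natr natrM /b.
  by rewrite le_eqVlt; apply/orP; left; apply/eqP; ring.
apply: ler_sum => j _; rewrite -sumrB; apply: le_trans (ler_norm_sum _ _ _) _.
apply: ler_sum => i _.
have m1 : (1 : R) <= m%:R by rewrite ler1n (leq_trans _ (ltn_ord i)).
have [Q_le QC_le] := QC i j; rewrite -/Q -/C in Q_le QC_le.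
have C_le : `|C i j| <= 1 / g.
  rewrite /C !mxE; case: eqP => _; last by rewrite mulr0n normr0 divr_ge0 ?ltW.
  have ci : 0 < c 0 i := lt_le_trans g0 (cg i).
  by rewrite mulr1n div1r gtr0_norm ?invr_gt0 // lef_pV2 ?posrE.
have -> : (K + D) u i * Q i j * (K + D) v j - K u i * C i j * K v j =
   D u i * Q i j * (K v j + D v j) + K u i * (Q i j - C i j) * (K v j + D v j)
   + K u i * C i j * D v j by rewrite !mxE; ring.
have KD : `|K v j + D v j| <= 2.
  by apply: le_trans (ler_normD _ _) _; have := K1 v j; have := De v j; lra.
have h1 : `|D u i * Q i j * (K v j + D v j)| <= e * (2 / g) * 2.
  by rewrite !normrM !ler_pM ?mulr_ge0.
have h2 : `|K u i * (Q i j - C i j) * (K v j + D v j)|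
    <= 1 * (2 * m%:R * e / g ^+ 2) * 2.
  by rewrite !normrM !ler_pM ?mulr_ge0.
have h3 : `|K u i * C i j * D v j| <= 1 * (1 / g) * e.
  by rewrite !normrM !ler_pM ?mulr_ge0.
apply: le_trans (ler_normD _ _) _.
apply: le_trans (lerD (le_trans (ler_normD _ _) (lerD h1 h2)) h3) _.
have e0 : 0 <= e := le_trans (normr_ge0 _) (De u i).
rewrite /b.
have -> : e * (2 / g) * 2 + 1 * (2 * m%:R * e / g ^+ 2) * 2 + 1 * (1 / g) * e =
  (5 * g * e + 4 * m%:R * e) / g ^+ 2 by field; exact: lt0r_neq0.
rewrite ler_pM2r ?invr_gt0 ?exprn_gt0 //.
have : g * e <= 1 * e by rewrite ler_wpM2r.
have : 1 * e <= m%:R * e by rewrite ler_wpM2r.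
by lra.
Qed.

(** * From low rank to colourings *)

Lemma entry_le_frobenius (R : realType) (N : nat) (M : 'M[R]_N) (i j : 'I_N) :
  `|M i j| <= frobenius_norm M.
Proof.
rewrite -sqrtr_sqr ler_wsqrtr // (bigD1 i) //= (bigD1 j) //= -addrA lerDl.
rewrite addr_ge0 ?sumr_ge0 // => l _; first exact: sqr_ge0.
by rewrite sumr_ge0 // => ? _; rewrite sqr_ge0.
Qed.

(** Two copies of a vertex have inner product almost 1, so one of them is not
    short; the normalised vector of such a copy represents the vertex.  The
    assumption on the Gram matrix speaks of the pairs outside the index graph
    because these are exactly the edges of the supergraph and the pairs of
    copies of a vertex. *)
Lemma near_gram_colorable (R : realType) (G : sgraph)
    (V : 'M[R]_(p1_n G, 3)) :
    (forall i j, i != j -> ~~ p1_adj (enum_val i) (enum_val j) ->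
       `|(V *m V^T) i j - p1_A R G i j| <= 10 ^- 9) ->
  colorable 3 G.
Proof.
move=> near; set t : R := 10 ^- 9 in near.
have t9 : t * 10 ^+ 9 = 1 by rewrite /t; field.
pose r (x : peeters G) (mu : 'I_3) := row (enum_rank ((x, mu) : p1_graph G)) V.
have near_r x mu y nu : (x, mu) != (y, nu) -> ~~ nonedge x y ->
    `|dot (r x mu) (r y nu) - (if adj x y then 0 else 1)| <= t.
  move=> xy nxy.
  have := near (enum_rank ((x, mu) : p1_graph G)) (enum_rank ((y, nu) : p1_graph G)).
  rewrite (inj_eq enum_rank_inj) gram_rowE /p1_A mxE !enum_rankK /p1_adj.
  move=> /(_ xy nxy) /=.
  by rewrite (negPf nxy) xy.
have copies x : 1 - t <= dot (r x 0) (r x 1).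
  have := @near_r x 0 x 1; rewrite xpair_eqE /nonedge eqxx adj_irr => /(_ isT isT).
  by rewrite ler_norml => /andP[]; lra.
have long x : exists mu, 1 / 4 <= dot (r x mu) (r x mu).
  have := dot_ge0 (r x 0 + (-1) *: r x 1); have := copies x.
  rewrite !(dotDl, dotDr, dotZl, dotZr) (dotC (r x 1) (r x 0)).
  have [le0 _ _|lt0] := lerP (1 / 4) (dot (r x 0) (r x 0)); first by exists 0.
  by exists 1; lra.
have [s s_long] : exists s : peeters G -> 'I_3,
    forall x, 1 / 4 <= dot (r x (s x)) (r x (s x)).
  exists (fun x => odflt 0 [pick mu | 1 / 4 <= dot (r x mu) (r x mu)]) => x.
  by case: pickP => [//|none]; case: (long x) => mu; rewrite none.
pose N x := Num.sqrt (dot (r x (s x)) (r x (s x))).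
have N2 x : N x ^+ 2 = dot (r x (s x)) (r x (s x)) by rewrite sqr_sqrtr ?dot_ge0.
have N_half x : 1 / 2 <= N x.
  rewrite -(@ler_pXn2r _ 2) ?nnegrE ?divr_ge0 ?sqrtr_ge0 // N2.
  by have := s_long x; lra.
have N_gt0 x : 0 < N x by have := N_half x; lra.
have Ninv_le x : (N x)^-1 <= 2.
  by rewrite -[2]invrK lef_pV2 ?posrE ?invr_gt0 //; have := N_half x; lra.
apply: (@peeters_near_rep_colorable _ _ (fun x => (N x)^-1 *: r x (s x))).
  by move=> x; rewrite dotZl dotZr -N2; field; rewrite gt_eqF.
have Nabs x : `|(N x)^-1| = (N x)^-1 by rewrite gtr0_norm ?invr_gt0.
move=> x y xy; rewrite dotZl dotZr !normrM !Nabs.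
have xNy : x != y by apply/eqP=> exy; rewrite exy adj_irr in xy.
have := @near_r x (s x) y (s y).
rewrite xpair_eqE (negPf xNy) /nonedge xy andbF subr0 => /(_ isT isT) dxy.
apply: (@le_trans _ _ (2 * (2 * t))).
  by rewrite !ler_pM ?mulr_ge0 ?invr_ge0 ?Ninv_le ?(ltW (N_gt0 _)).
have : (10 : R) ^- 8 * 10 ^+ 8 = 1 by field.
by lra.
Qed.

(** A perturbation of size 10^-12 k^-2 m^-3, read as zero when m = 0,
    satisfies the first two bounds.  The first one keeps the
    minors and the diagonal under control also when m is zero, the second one
    absorbs the loss in the Schur complement. *)
Lemma p1_low_rank_colorable (R : realType) (G : sgraph) (e : R)
    (d : 'rV[R]_(p1_m G + p1_n G)) (H : 'M[R]_(p1_m G + p1_n G)) :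
    let k : R := (p1_k G)%:R in
    e * k ^+ 2 <= 10 ^- 12 -> e * k ^+ 2 * (p1_m G)%:R ^+ 3 <= 10 ^- 12 ->
    (forall j, 0 <= d 0 j) -> H \is symmetricmx -> frobenius_norm H <= e ->
    psdmx (p1_B R G - diag_mx d + H) ->
    (\rank (p1_B R G - diag_mx d + H)%R <= p1_m G + 3)%N ->
  colorable 3 G.
Proof.
move=> k ek2 ek2m3 d0; rewrite symmetricmxE => /eqP symH He.
set m := p1_m G in d H ek2 ek2m3 d0 symH He *; set n := p1_n G in d H d0 symH He *.
have He_ij i j : `|H i j| <= e by apply: le_trans (entry_le_frobenius _ _ _) He.
have e0 : 0 <= e by apply: le_trans He; apply: sqrtr_ge0.
have k1 : 1 <= k by rewrite ler1n /p1_k addn1.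
have k0 : 0 < k by lra.
set t : R := 10 ^- 12 in ek2 ek2m3.
have t12 : t * 10 ^+ 12 = 1 by rewrite /t; field.
have t0 : 0 < t by rewrite /t invr_gt0 exprn_gt0.
have ek : e * k <= t.
  by apply: le_trans ek2; rewrite ler_wpM2l // expr2 ler_peMl // ltW.
have et : e <= t by apply: le_trans ek; rewrite ler_peMr.
pose K : 'M[R]_(n, m) := incidence_mx R (p1_graph G).
pose c : 'rV[R]_m := \row_i (k - d 0 (lshift n i)).
pose E := ulsubmx H; pose D := dlsubmx H.
pose Q := p1_A R G + k%:M - diag_mx (rsubmx d) + drsubmx H.
have -> : p1_B R G - diag_mx d + H = block_mx (diag_mx c + E) (K + D)^T (K + D) Q.
  rewrite p1_B_sub_diag -[H in LHS]submxK add_block_mx /E /D linearD /= trmx_dlsub symH.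
  done.
move=> psdM rankM.
pose g := (4 * k)^-1.
have kg : k * g = 1 / 4 by rewrite /g; field; rewrite gt_eqF.
have cg i : g <= c 0 i.
  (* The entry of M at an edge and one of its ends is about 1, and the diagonal
     entry at that end is at most about k. *)
  have [j Kji] := edge_has_end R i; rewrite -/K in Kji.
  have := psd_minor2 (lshift n i) (rshift m j) psdM.
  have := psd_diag_ge0 (lshift n i) psdM.
  rewrite !(block_mxEul, block_mxEur, block_mxEdr) => ii0 minor.
  have E_i : `|E i i| <= e by rewrite !mxE.
  have D_ji : `|D j i| <= e by rewrite !mxE.
  have Q_j : Q j j <= k + e.
    have := d0 (rshift m j); have := ler_norm (H (rshift m j) (rshift m j)).
    have := He_ij (rshift m j) (rshift m j).
    rewrite /Q !mxE /nonedge !eqxx adj_irr /= !mulr1n.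
    by lra.
  have ME : (diag_mx c + E) i i = c 0 i + E i i.
    by rewrite [LHS]mxE [diag_mx c i i]mxE eqxx mulr1n.
  have LE : (K + D)^T i j = 1 + D j i by rewrite [LHS]mxE [LHS]mxE Kji.
  move: minor ii0; rewrite ME LE; set y := c 0 i + E i i => minor y0.
  have L1 : 9 / 10 <= (1 + D j i) ^+ 2.
    have : (1 - t) ^+ 2 <= (1 + D j i) ^+ 2.
      rewrite lerXn2r ?nnegrE; move: D_ji; rewrite ler_norml => /andP[]; lra.
    by have := sqr_ge0 t; lra.
  have yQ : y * Q j j <= y * (k + e) by rewrite ler_wpM2l.
  have yk : y * e <= y * (k / 10) by rewrite ler_wpM2l //; lra.
  have c_y : y - e <= c 0 i.
    by rewrite /y; move: E_i; rewrite ler_norml => /andP[]; lra.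
  by apply: le_trans c_y; rewrite -(ler_pM2l k0); lra.
have e1 : e <= 1 by lra.
have g0 : 0 < g by rewrite /g invr_gt0 mulr_gt0.
have g1 : g <= 1.
  by rewrite -[1]invr1 lef_pV2 ?posrE ?mulr_gt0 //; lra.
have m3 : (m%:R : R) <= m%:R ^+ 3.
  by rewrite -natrX ler_nat; case: (m) => // m'; apply: (@leq_pexp2l m'.+1 1 3).
have mge : 2 * m%:R * e <= g.
  rewrite -(@ler_pM2l _ (k ^+ 2)) ?exprn_gt0 //.
  have -> : k ^+ 2 * g = k / 4 by rewrite expr2 -mulrA kg mul1r.
  have : e * k ^+ 2 * m%:R <= e * k ^+ 2 * m%:R ^+ 3 
    by rewrite ler_wpM2l // mulr_ge0 ?exprn_ge0 ?(ltW k0).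
  by lra.
have E_le i j : `|E i j| <= e by rewrite !mxE.
have D_le i j : `|D i j| <= e by rewrite !mxE.
have K_le i j : `|K i j| <= 1 by rewrite mxE; case: (_ \in _); rewrite ?normr1 ?normr0.
have uP := near_diag_unitmx g0 cg E_le mge.
have [psdS rankS] := schur_complement uP psdM rankM.
have [V VE] := psd_gram psdS rankS.
apply: (@near_gram_colorable R G V) => i j ij nadj; rewrite -VE.
have := schur_term_perturbation g0 g1 e1 mge cg E_le K_le D_le i j.
have -> : (K *m diag_mx (\row_l (c 0 l)^-1) *m K^T) i j = 0.
  rewrite mxE big1 // => l _; rewrite mul_mx_diag [K^T l j]mxE [X in X * _]mxE mulrAC.
  by rewrite incidence_mul0 ?mul0r.
have QA : `|Q i j - p1_A R G i j| <= e.
  have -> : Q i j - p1_A R G i j = H (rshift m i) (rshift m j).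
    rewrite /Q; set A := p1_A R G; rewrite !mxE (negPf ij) !mulr0n.
    by rewrite addr0 subr0 addrC addKr.
  by [].
set x := (_ *m _) i j; rewrite subr0 => x_le.
have -> : (Q - (K + D) *m invmx (diag_mx c + E) *m (K + D)^T) i j - p1_A R G i j
   = Q i j - p1_A R G i j - x.
  by rewrite [(Q - _) i j]mxE [fun_of_matrix (- _) i j]mxE -/x addrAC.
apply: le_trans (ler_normB _ _) _; apply: le_trans (lerD QA x_le) _.
have -> : 9 * m%:R ^+ 3 * e / g ^+ 2 = 144 * (e * k ^+ 2 * m%:R ^+ 3).
  by rewrite /g; field; rewrite gt_eqF.
have : (10 : R) ^- 9 * 10 ^+ 9 = 1 by field.
by lra.
Qed.

Theorem theorem3p10 (R : realType) :
  exists eps0 c1 sigma tau : R,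
    [/\ 0 < eps0, 0 < c1, 0 < sigma & 0 < tau] /\
    forall G : sgraph,
      let n := p1_n G in
      let m := p1_m G in
      let k := p1_k G in
      let B := p1_B R G in
      let eps5 := c1 * eps0 * k%:R `^ (- sigma) * m%:R `^ (- tau) in
      (colorable 3 G ->
         exists d : 'rV[R]_(m + n),
           [/\ forall j, 0 <= d 0 j,
               psdmx (B - diag_mx d) &
               (\rank (B - diag_mx d)%R <= m + 3)%N]) /\
      ((exists (d : 'rV[R]_(m + n)) (H : 'M[R]_(m + n)),
           [/\ forall j, 0 <= d 0 j,
               H \is symmetricmx,
               frobenius_norm H <= eps5,
               psdmx (B - diag_mx d + H) &
               (\rank (B - diag_mx d + H)%R <= m + 3)%N]) ->
         colorable 3 G).
Proof.
exists (10 ^- 12), 1, 2, 3; split=> [|G n m k B eps5].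
  by split; rewrite // invr_gt0 exprn_gt0.
split=> [|[d [H [d0 symH He psdM rankM]]]]; first exact: p1_low_rank.
have k0 : (0 : R) < k%:R by rewrite ltr0n /k /p1_k addn1.
have tol_ge0 : (0 : R) <= 10 ^- 12 by rewrite invr_ge0 exprn_ge0.
have epsE : eps5 * k%:R ^+ 2 = 10 ^- 12 * (m%:R ^+ 3)^-1.
  rewrite /eps5 !powRN !powR_mulrn ?ler0n // mul1r mulrAC mulfVK //.
  by rewrite expf_neq0 // gt_eqF.
apply: (@p1_low_rank_colorable R G eps5 d H) => //; rewrite -/k -/m epsE.
  rewrite ler_piMr //; case: (posnP m) => [->|m0]; first by rewrite expr0n invr0.
  by rewrite invf_le1 ?exprn_gt0 ?ltr0n // exprn_ege1 // ler1n.
rewrite -mulrA ler_piMr //; case: (posnP m) => [->|m0].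
  by rewrite expr0n mulr0.
by rewrite mulVf // expf_neq0 // pnatr_eq0 -lt0n.
Qed.
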